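(* There are exactly $2^{\aleph_0}$ congruential modal logics which are both C-Post complete and neighborhood-complete. Moreover, there is a family of $2^{\aleph_0}$ pairwise distinct C-Post complete congruential modal logics such that each member $\Lambda$ of the family is the logic of a single countable neighborhood frame, i.e. $\Lambda=\{\varphi : \mathfrak{F}\Vdash\varphi\}$ for some neighborhood frame $\mathfrak{F}=\langle W,N\rangle$ with $W$ countable.
   Context: Language: formulas are built from a countably infinite set of propositional letters using $\land$, $\lnot$, $\bot$ and a unary connective $\Box$; the connectives $\top,\to,\lor,\leftrightarrow$ are defined as usual. A set $\Lambda$ of formulas is a modal logic if it contains all propositional tautologies and is closed under modus ponens and uniform substitution. A modal logic $\Lambda$ is congruential if, for all formulas $\varphi,\psi$, $\varphi\leftrightarrow\psi\in\Lambda$ implies $\Box\varphi\leftrightarrow\Box\psi\in\Lambda$. A modal logic is consistent if it is not the set of all formulas (equivalently, $\bot\notin\Lambda$). A neighborhood frame is a pair $\mathfrak{F}=\langle W,N\rangle$ where $W$ is a nonempty set and $N:W\to\wp(\wp(W))$ is an arbitrary function. An evaluation $V$ assigns a subset of $W$ to each propositional letter. Truth at $w\in W$ is defined recursively: $\mathfrak{F},V,w\Vdash p$ iff $w\in V(p)$ for a propositional letter $p$; $\bot$ is never true; $\mathfrak{F},V,w\Vdash\varphi\land\psi$ iff $\mathfrak{F},V,w\Vdash\varphi$ and $\mathfrak{F},V,w\Vdash\psi$; $\mathfrak{F},V,w\Vdash\lnot\varphi$ iff not $\mathfrak{F},V,w\Vdash\varphi$; $\mathfrak{F},V,w\Vdash\Box\varphi$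 iff $\{x\in W:\mathfrak{F},V,x\Vdash\varphi\}\in N(w)$. The formula $\varphi$ is valid on $\mathfrak{F}$, written $\mathfrak{F}\Vdash\varphi$, if $\mathfrak{F},V,w\Vdash\varphi$ for every evaluation $V$ and every $w\in W$. The logic of the frame $\mathfrak{F}$ is $\{\varphi:\mathfrak{F}\Vdash\varphi\}$. A logic $\Lambda$ is neighborhood-complete if there is a class $\mathsf{F}$ of neighborhood frames such that $\Lambda=\{\varphi:\mathfrak{F}\Vdash\varphi\text{ for all }\mathfrak{F}\in\mathsf{F}\}$. A logic $\Lambda$ is C-Post complete if it is congruential, consistent, and has no proper consistent congruential extension (i.e. no consistent congruential modal logic properly contains $\Lambda$). *)

(* Defs.v *)
From mathcomp Require Import all_boot.
From mathcomp Require Import boolp classical_sets.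

Set Implicit Arguments.
Unset Strict Implicit.
Unset Printing Implicit Defensive.

Local Open Scope classical_set_scope.

Inductive form : Type :=
  | Var of nat
  | Bot
  | And of form & form
  | Not of form
  | Box of form.

Definition Imp (a b : form) : form := Not (And a (Not b)).
Definition Iff (a b : form) : form := And (Imp a b) (Imp b a).

Fixpoint subst (s : nat -> form) (a : form) : form :=
  match a with
  | Var p => s p
  | Bot => Bot
  | And b c => And (subst s b) (subst s c)
  | Not b => Not (subst s b)
  | Box b => Box (subst s b)
  end.

(* Classical two-valued evaluation in which letters and boxed formulas are
   both treated as atoms, with truth values prescribed by [e]. *)
Fixpoint beval (e : form -> bool) (a : form) : bool :=
  match a with
  | Var _ | Box _ => e a
  | Bot => false
  | And b c => beval e b && beval e c
  | Not b => ~~ beval e b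
  end.

Definition tautology (a : form) : Prop := forall e, beval e a.

Definition modal_logic (L : set form) : Prop :=
  [/\ tautology `<=` L,
      forall a b, L a -> L (Imp a b) -> L b
    & forall s a, L a -> L (subst s a)].

Definition congruential (L : set form) : Prop :=
  forall a b, L (Iff a b) -> L (Iff (Box a) (Box b)).

Definition congruential_logic (L : set form) : Prop :=
  modal_logic L /\ congruential L.

Definition consistent (L : set form) : Prop := L <> [set: form].

Record nframe : Type := NFrame {
  world :> Type;
  nbhd : world -> set (set world);
  world_inhabited : inhabited world
}.

Fixpoint sat (F : nframe) (V : nat -> set F) (a : form) (w : F) : Prop :=
  match a with
  | Var p => V p w
  | Bot => False
  | And b c => sat V b w /\ sat V c w
  | Not b => ~ sat V b w
  | Box b => nbhd w [set x | sat V b x]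
  end.

Definition valid (F : nframe) (a : form) : Prop :=
  forall (V : nat -> set F) (w : F), sat V a w.

Definition frame_logic (F : nframe) : set form := [set a | valid F a].

Definition nbhd_complete (L : set form) : Prop :=
  exists C : set nframe, L = [set a | forall F, C F -> valid F a].

Definition CPost_complete (L : set form) : Prop :=
  [/\ congruential_logic L,
      consistent L
    & ~ exists L', [/\ congruential_logic L', consistent L' & L `<` L']].

(* Main.v *)
Require Import Defs.
From mathcomp Require Import all_boot.
From mathcomp Require Import boolp classical_sets functions cardinality.
From mathcomp Require Import zify.

(** For each [X] take the frame on [nat] whose box sends the full set to itself,
    the empty set to [{0}], [{n}] to [{n+1}], the complement of [{n}] to [{n}] if
    [n] is in [X] and to the empty set otherwise, and all other sets to the empty
    set.  Every singleton [{n}] is then defined by a closed formula [c_n], and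
    [X] can be read off the logic from the validity of [Not (Box (Not c_n))].
    Composing an evaluation with the retraction [min(-, n)] does not affect the
    truth of a given formula at worlds below [n] once [n] is large enough, because
    the special sets are all very small or very large; so every refutable
    formula has a refutable closed instance.  An extension of the logic that
    proves this instance proves some [Not c_n], hence by congruence
    [Box (Not c_n)], being equivalent to the theorem [Box Top].  But
    [Box (Not c_n)] implies [c_n] in the logic, so the extension is
    inconsistent. *)

Set Implicit Arguments.
Unset Strict Implicit.
Unset Printing Implicit Defensive.

Local Open Scope classical_set_scope.
Local Open Scope card_scope.

(** * Countability of formulas and the upper bound on the number of logics *)

Fixpoint form_tree (a : form) : GenTree.tree nat :=
  match a with
  | Var p => GenTree.Leaf p
  | Bot => GenTree.Node 0 [::]
  | And b c => GenTree.Node 1 [:: form_tree b; form_tree c]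
  | Not b => GenTree.Node 2 [:: form_tree b]
  | Box b => GenTree.Node 3 [:: form_tree b]
  end.

Lemma form_tree_inj : injective form_tree.
Proof.
elim=> [p||b IHb c IHc|b IHb|b IHb] [q||b' c'|b'|b'] //=.
- by case=> ->.
- by case=> /IHb -> /IHc ->.
- by case=> /IHb ->.
- by case=> /IHb ->.
Qed.

(** Generic trees are countable, which numbers the formulas; direct image under an injective
    numbering is injective on sets. *)
Lemma card_le_set_form (A : set (set form)) : A #<= [set: set nat].
Proof.
pose code (a : form) := pickle (form_tree a).
have code_inj : injective code.
  by move=> a b /(pcan_inj pickleK) /form_tree_inj.
apply/pcard_injP; exists (image^~ code) => L L' _ _ /= eqLL'.
by apply/funext => a; rewrite -(image_inj (A := L) code_inj) eqLL' image_inj.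
Qed.

(** * Derived rules of modal logics *)

Section ModalLogic.
Variable L : set form.
Hypothesis logicL : modal_logic L.

Lemma logic_mp (a b : form) : L a -> L (Imp a b) -> L b.
Proof. by case: logicL => _ mp _; exact: mp. Qed.

Lemma logic_taut (a : form) : tautology a -> L a.
Proof. by case: logicL => taut _ _; exact: taut. Qed.

Lemma logic_subst (s : nat -> form) (a : form) : L a -> L (subst s a).
Proof. by case: logicL => _ _; exact. Qed.

Lemma logic_bot : L Bot -> L = [set: form].
Proof.
by move=> LBot; apply/seteqP; split=> // a _; apply: logic_mp LBot (logic_taut _).
Qed.

Lemma logic_iff_top (a : form) : L a -> L (Iff a (Not Bot)).
Proof.
by move=> La; apply: logic_mp La (logic_taut _) => e /=; case: (beval e a).
Qed.

Lemma logic_iff_mp (a b : form) : L (Iff a b) -> L b -> L a.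
Proof.
move=> Lab Lb; apply: logic_mp Lb _; apply: logic_mp Lab (logic_taut _) => e /=.
by case: (beval e a); case: (beval e b).
Qed.

Lemma logic_contra (a : form) : L a -> L (Not a) -> L Bot.
Proof.
move=> La LNa; apply: logic_mp LNa _; apply: logic_mp La (logic_taut _) => e /=.
by case: (beval e a).
Qed.

End ModalLogic.

(** * Logics of neighborhood frames *)

Section FrameLogic.
Variable F : nframe.

Lemma sat_Imp (V : nat -> set F) (a b : form) (w : F) :
  sat V (Imp a b) w <-> (sat V a w -> sat V b w).
Proof.
split=> /= [nab sa|ab [sa nsb]]; last exact/nsb/ab.
by apply: contrapT => nsb; apply: nab.
Qed.

Lemma sat_Iff (V : nat -> set F) (a b : form) (w : F) :
  sat V (Iff a b) w <-> (sat V a w <-> sat V b w).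
Proof.
change (sat V (Imp a b) w /\ sat V (Imp b a) w <-> (sat V a w <-> sat V b w)).
by rewrite !sat_Imp.
Qed.

(** At a fixed world, letters and boxed formulas act as Boolean atoms; hence tautologies are
    valid. *)
Lemma sat_beval (V : nat -> set F) (a : form) (w : F) :
  sat V a w <-> beval (fun b => `[< sat V b w >]) a.
Proof.
elim: a => [p||b IHb c IHc|b IHb|b _] /=.
- by split=> /asboolP.
- by [].
- by rewrite IHb IHc; split=> /andP.
- by rewrite IHb; split=> /negP.
- by split=> /asboolP.
Qed.

Lemma sat_subst (V : nat -> set F) (s : nat -> form) (a : form) :
  sat V (subst s a) = sat (fun p => sat V (s p)) a.
Proof. by elim: a => //= [b -> c ->|b ->|b ->]. Qed.

Lemma frame_logic_congruential : congruential_logic (frame_logic F).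
Proof.
split; first split.
- by move=> a taut V w; apply/sat_beval; exact: taut.
- by move=> a b va vab V w; apply: (sat_Imp V a b w).1 (vab V w) (va V w).
- by move=> s a va V w; rewrite sat_subst; exact: va.
- move=> a b vab V w; apply/sat_Iff => /=.
  suff -> : [set x | sat V a x] = [set x | sat V b x] by [].
  by apply/funext => x; apply/propext/sat_Iff/vab.
Qed.

Lemma frame_logic_consistent : consistent (frame_logic F).
Proof.
move=> eqT; have [w] := world_inhabited F.
have : frame_logic F Bot by rewrite eqT.
by move=> /(_ (fun _ => set0) w).
Qed.

Lemma frame_logic_nbhd_complete : nbhd_complete (frame_logic F).
Proof.
exists [set F]; apply/seteqP; split=> a /=; first by move=> va G ->.
by apply.
Qed.

End FrameLogic.

(** * Frames coding sets of naturals *)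

Definition coding_nbhd (X : set nat) (w : nat) : set (set nat) :=
  [set U | [\/ U = setT, U = set0 /\ w = 0,
               exists2 n, U = [set n] & w = n.+1
             | exists2 n, U = ~` [set n] & X n /\ w = n]].

Definition coding_frame (X : set nat) : nframe :=
  @NFrame nat (coding_nbhd X) (inhabits 0).

Definition point_form (n : nat) : form := iter n.+1 Box Bot.

(** A closed definition of the set that agrees with [S] below [n] and has constant value [b] from
    [n] on; each step adds or removes one point. *)
Fixpoint truncation_form (S : set nat) (b : bool) (n : nat) : form :=
  match n with
  | 0 => if b then Not Bot else Bot
  | k.+1 => if `[< S k >]
      then Not (And (Not (point_form k)) (Not (truncation_form S b k)))
      else And (Not (point_form k)) (truncation_form S b k)
  end.

Section CodingFrame.
Variable X : set nat.
Let F := coding_frame X.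

Lemma coding_nbhdT (w : nat) : coding_nbhd X w setT.
Proof. exact: Or41. Qed.

Lemma coding_nbhd0 (w : nat) : coding_nbhd X w set0 <-> w = 0.
Proof.
split=> [|->]; last exact: Or42.
case=> [/predeqP/(_ 0)|[]//|[n /predeqP/(_ n)]|[n /predeqP/(_ n.+1)]] /=; lia.
Qed.

Lemma coding_nbhd1 (n w : nat) : coding_nbhd X w [set n] <-> w = n.+1.
Proof.
split=> [|->]; last by apply: Or43; exists n.
case=> [/predeqP/(_ n.+1)|[/predeqP/(_ n)]|[m /predeqP/(_ n)]|[m eqn]] /=.
- lia.
- lia.
- lia.
(* Both [n.+1] and [n.+2] lie outside the singleton, so both would equal [m]. *)
- have /= := (predeqP _ _).1 eqn n.+1; have /= := (predeqP _ _).1 eqn n.+2; lia.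
Qed.

Lemma coding_nbhdC1 (n w : nat) :
  coding_nbhd X w (~` [set n]) <-> X n /\ w = n.
Proof.
split=> [|Xw]; last by apply: Or44; exists n.
case=> [/predeqP/(_ n)|[/predeqP/(_ n.+1)]|[m eqn]|[m eqn]] /=.
- lia.
- lia.
- have /= := (predeqP _ _).1 eqn n.+1; have /= := (predeqP _ _).1 eqn n.+2; lia.
- have /= := (predeqP _ _).1 eqn n; have [-> //|] := pselect (n = m); lia.
Qed.

(** Each of the four kinds of special set has at most one element or misses at most one. *)
Lemma coding_nbhd_generic (U : set nat) (a b c d w : nat) :
  a <> b -> U a -> U b -> c <> d -> ~ U c -> ~ U d -> ~ coding_nbhd X w U.
Proof.
move=> ab Ua Ub cd nUc nUd.
case=> [eqU|[eqU _]|[n eqU _]|[n eqU _]]; move: Ua Ub nUc nUd; rewrite eqU /=; lia.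
Qed.

Lemma coding_nbhd_truncation (U : set nat) :
  exists m, forall n, m <= n -> forall w,
    coding_nbhd X w (minn^~ n @^-1` U) <-> coding_nbhd X (minn w n) U.
Proof.
have [->|UT] := pselect (U = setT).
  by exists 0 => n _ w; rewrite preimage_setT; split=> _; exact: coding_nbhdT.
have [->|U0] := pselect (U = set0).
  by exists 1 => n ? w; rewrite preimage_set0 !coding_nbhd0; lia.
have [a Ua] : exists a, U a by apply/set0P/eqP.
have [c nUc] : exists c, ~ U c.
  by apply/existsNP => allU; apply: UT; apply/seteqP; split.
have [->|U1] := pselect (U = [set a]).
  (* Truncation must fix not only [a] but also [a.+1], the world where the box of the singleton
     holds, and send no other world there. *)
  exists a.+2 => n an w.
  have -> : minn^~ n @^-1` [set a] = [set a].
    by apply/funext => x; apply/propext => /=; lia.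
  rewrite !coding_nbhd1; lia.
have [->|UC1] := pselect (U = ~` [set c]).
  exists c.+2 => n cn w.
  have -> : minn^~ n @^-1` (~` [set c]) = ~` [set c].
    by apply/funext => x; apply/propext => /=; lia.
  have minE : (minn w n = c) = (w = c) by apply/propext; lia.
  by rewrite !coding_nbhdC1 minE.
have [b [Ub ba]] : exists b, U b /\ b <> a.
  apply: contrapT => /forallNP nb; apply: U1; apply/seteqP; split=> [x Ux|_ ->] //=.
  by apply: contrapT => xa; apply: (nb x).
have [d [nUd dc]] : exists d, ~ U d /\ d <> c.
  apply: contrapT => /forallNP nd; apply: UC1; apply/seteqP.
  split=> [x Ux /= xc|x /= xc]; first by rewrite -xc in nUc.
  by apply: contrapT => nUx; apply: (nd x).
(* Truncation at [n] fixes all four witnesses, so neither [U] nor its preimage is special. *)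
exists (maxn (maxn a b) (maxn c d)) => n nmax w.
split=> nbU; exfalso; last first.
  exact: (coding_nbhd_generic ba Ub Ua dc nUd nUc nbU).
have minE x : x <= n -> (minn^~ n @^-1` U) x = U x by move=> /= /minn_idPl ->.
by apply: (coding_nbhd_generic ba _ _ dc _ _ nbU); rewrite minE //; lia.
Qed.

Lemma sat_truncation (V : nat -> set F) (a : form) :
  exists m, forall n, m <= n -> forall w : nat,
    sat (F := F) (fun p => minn^~ n @^-1` V p) a w <-> sat V a (minn w n).
Proof.
elim: a => [p||b [m IHb] c [k IHc]|b [m IHb]|b [m IHb]] /=.
- by exists 0.
- by exists 0.
- exists (maxn m k) => n; rewrite geq_max => /andP[mn kn] w.
  by rewrite IHb // IHc.
- by exists m => n mn w; rewrite IHb.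
(* By induction the truth set of [b] under the truncated evaluation is the preimage of its original
   truth set. *)
- have [k IHk] := coding_nbhd_truncation [set x | sat V b x].
  exists (maxn m k) => n; rewrite geq_max => /andP[mn kn] w.
  rewrite -IHk //; set A := [set x | _]; set B := minn^~ n @^-1` _.
  suff -> : A = B by [].
  by apply/funext => x; apply/propext/IHb.
Qed.

Lemma sat_point_form (V : nat -> set F) (n w : nat) :
  sat (F := F) V (point_form n) w <-> w = n.
Proof.
elim: n w => [|n IHn] w; first exact: coding_nbhd0.
rewrite -coding_nbhd1 /=.
suff -> : [set x | sat V (point_form n) x] = [set n] by [].
by apply/funext => x; apply/propext/IHn.
Qed.

Lemma sat_truncation_form (V : nat -> set F) (S : set nat) (b : bool) (n w : nat) :
  sat (F := F) V (truncation_form S b n) w <-> if w < n then S w else b.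
Proof.
elim: n => [|n IHn]; first by case: b => /=; split=> // _ [].
rewrite ltnS leq_eqVlt /=; have [Sn|nSn] := asboolP (S n).
- change (~ (~ sat (F := F) V (point_form n) w /\
    ~ sat V (truncation_form S b n) w) <-> if (w == n) || (w < n) then S w else b).
  rewrite sat_point_form IHn; have [->|/eqP wn] /= := eqVneq w n.
    by split=> // _ [].
  by split=> [/not_andP[//|/contrapT]|? []].
- change (~ sat (F := F) V (point_form n) w /\
    sat V (truncation_form S b n) w <-> if (w == n) || (w < n) then S w else b).
  rewrite sat_point_form IHn; have [->|/eqP wn] /= := eqVneq w n.
    by split=> [[]|].
  by split=> [[]|].
Qed.

Lemma closed_refutation (a : form) : ~ valid F a ->
  exists (s : nat -> form) (w : nat), forall V, ~ sat (F := F) V (subst s a) w.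
Proof.
move=> /existsNP[V /existsNP[w nsat]].
(* Taking [n] at least [w] makes truncation fix the refuting world. *)
have [m truncm] := sat_truncation V a; pose n := maxn m w.
(* The truncated evaluation of [p] is constant from [n] on, with the value of [V p] at [n], so a
   closed formula defines it. *)
exists (fun p => truncation_form (V p) `[< V p n >] n), w => V'.
rewrite sat_subst => sata; apply: nsat.
have <- : minn w n = w by apply/minn_idPl/leq_maxr.
apply/truncm; first exact: leq_maxl.
move: sata; congr (sat _ a w).
apply/funext => p; apply/funext => x; apply/propext.
rewrite sat_truncation_form /preimage /=.
case: ltnP => // _.
by split=> /asboolP.
Qed.

Lemma valid_box_top : valid F (Box (Not Bot)).
Proof.
move=> V w; have := coding_nbhdT w; congr (coding_nbhd X w _).
by apply/seteqP; split=> // x _ /=.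
Qed.

Lemma sat_box_not_point (V : nat -> set F) (n w : nat) :
  sat (F := F) V (Box (Not (point_form n))) w <-> X n /\ w = n.
Proof.
rewrite -coding_nbhdC1 [sat _ _ _]/=.
suff -> : [set x : F | ~ sat V (point_form n) x] = ~` [set n] by [].
by apply/seteqP; split=> x npx px; apply: npx; apply/(sat_point_form V n x).
Qed.

Lemma coding_logic_CPost : CPost_complete (frame_logic F).
Proof.
split; [exact: frame_logic_congruential|exact: frame_logic_consistent|].
move=> [L [[logL congL] consL [subL nsubL]]]; apply: consL.
have [a La nva] : exists2 a, L a & ~ valid F a.
  apply: contrapT => none; apply: nsubL => a La.
  by apply: contrapT => nva; apply: none; exists a.
have [s [w nsat]] := closed_refutation nva.
(* The closed instance fails at [w] under every evaluation, so the frame validates that it implies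
   [Not (point_form w)]. *)
have Lnw : L (Not (point_form w)).
  apply: (logic_mp logL (logic_subst logL s La)); apply: subL => V x.
  by apply/sat_Imp => satx /sat_point_form eqx; rewrite eqx in satx; exact: nsat satx.
have Lbox : L (Box (Not (point_form w))).
  apply: (logic_iff_mp logL); last by apply: subL; exact: valid_box_top.
  by apply: congL; exact: logic_iff_top.
apply: (logic_bot logL); apply: (logic_contra logL _ Lnw).
apply: (logic_mp logL Lbox); apply: subL => V x.
by apply/sat_Imp => /sat_box_not_point[_ ->]; apply/sat_point_form.
Qed.

Lemma coding_logicP (n : nat) :
  frame_logic F (Not (Box (Not (point_form n)))) <-> ~ X n.
Proof.
split=> [vn Xn|nXn V w /sat_box_not_point[]//].
by apply: (vn (fun=> set0) n); apply/sat_box_not_point.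
Qed.

End CodingFrame.

(** * Counting the coded logics *)

Lemma coding_logic_inj : injective (fun X => frame_logic (coding_frame X)).
Proof.
move=> X Y /= eqXY; apply/funext => n; apply/propext.
by rewrite -[X n]not_notE -[Y n]not_notE -!coding_logicP eqXY.
Qed.

Theorem theorem2p3 :
  ([set L : set form | CPost_complete L /\ nbhd_complete L]
     #= [set: set nat]) /\
  (exists Lam : set nat -> set form,
     injective Lam /\
     forall X : set nat,
       CPost_complete (Lam X) /\
       exists F : nframe,
         countable [set: world F] /\ Lam X = frame_logic F).
Proof.
split.
  apply/card_eqPle; split; first exact: card_le_set_form.
  (* Lower bound: the range of the injective family lies among the logics being counted. *)
  have := inj_card_eq (A := [set: set nat]) (in2W coding_logic_inj).
  rewrite card_eq_sym => /card_eqPle[/card_le_trans + _]; apply.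
  apply: subset_card_le => _ [X _ <-].
  by split; [exact: coding_logic_CPost|exact: frame_logic_nbhd_complete].
exists (fun X => frame_logic (coding_frame X)); split; first exact: coding_logic_inj.
move=> X; split; first exact: coding_logic_CPost.
exists (coding_frame X); split=> //; exact: (@countableP nat).
Qed.
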